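(* Let $N>1$, $R>0$, $u_0>0$, let $f,g$ be locally Lipschitz non-negative increasing real functions, $G(s)=\int_0^s g(\sigma)\,d\sigma$, and let $\lambda>0$ satisfy $\lambda f(\tau)>\sqrt{2G(\tau)}$ for any $\tau>0$. Assume $\int_{r_0}^{\infty}\frac{ds}{\sqrt{G(s)}}<\infty$ for some $r_0>0$ and $$\liminf_{\tau\to\infty}\frac{f(\tau)}{\sqrt{2G(\tau)}}=L\in(0,\infty),\qquad \lambda>\frac1L.$$ Let $u^0(r,t)$ be the solution of the radial problem given in the context and $T_\infty$ its blow-up time. Then $$\liminf_{t\nearrow T_\infty}\frac{\Phi(u^0(R,t))}{T_\infty-t}\ge\frac{\lambda L-1}{L}.$$ More precisely, if $\limsup_{s\to\infty}\frac{\Phi(\eta s)}{\Phi(s)}<1$ for any $\eta>1$, then $$\limsup_{t\nearrow T_\infty}\frac{u^0(R,t)}{\Phi^{-1}\left(\frac{\lambda L-1}{L}(T_\infty-t)\right)}\le1.$$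
   Context: $\Phi(r)=\int_r^{+\infty}\frac{ds}{f(s)}$, a decreasing function with $\Phi(+\infty)=0$ and inverse $\Phi^{-1}$ (the integral is finite under the assumptions). The radial problem is $$-\frac{1}{r^{N-1}}\frac{\partial}{\partial r}\Big(r^{N-1}\frac{\partial u}{\partial r}(r,t)\Big)+g(u(r,t))=0,\ r<R,\ t>0;\qquad \frac{\partial u}{\partial r}(0,t)=0,\ t\ge0;$$ $$\frac{\partial u}{\partial t}(R,t)+\frac{\partial u}{\partial r}(R,t)=\lambda f(u(R,t)),\ t\ge0;\qquad u(R,0)=u_0>0.$$ $T_\infty$ is the first time at which $u^0(R,t)$ becomes infinite. *)

(* Defs.v *)
From HB Require Import structures.
From mathcomp Require Import all_boot all_order all_algebra.
From mathcomp Require Import all_classical all_reals all_analysis.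

Set Implicit Arguments.
Unset Strict Implicit.
Unset Printing Implicit Defensive.

Import Order.TTheory GRing.Theory Num.Theory.
Import numFieldNormedType.Exports.

Local Open Scope classical_set_scope.
Local Open Scope ring_scope.

(* Only meant for s >= 0: over `[0, s] with s < 0 the integral is 0, not
   the oriented integral. *)
Definition primitive {R : realType} (g : R -> R) (s : R) : R :=
  \int[lebesgue_measure]_(x in `[0, s]) g x.

(* The integral of 1/f over a half-line, real-valued: it would be 0 if the
   integral were infinite, which the assumptions of the theorem exclude for
   r > 0. *)
Definition Phi {R : realType} (f : R -> R) (r : R) : R :=
  \int[lebesgue_measure]_(s in `[r, +oo[) (f s)^-1.

(* The inverse of Phi restricted to r > 0, meaningful on the image of that
   half-line and equal to 0 elsewhere. *)
Definition Phi_inv {R : realType} (f : R -> R) : R -> R :=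
  'pinv_(fun=> 0) [set r : R | 0 < r] (Phi f).

(* l is the derivative at x of v restricted to A: two-sided at interior points
   of A, one-sided at an endpoint of an interval A; the values of v outside A
   are irrelevant. *)
Definition is_derive_within {R : realType} (A : set R) (v : R -> R)
    (x l : R) : Prop :=
  (v y - v x) / (y - x) @[y --> within A x^'] --> l.

(* Classical solution on [0, rho] x [0, T[ of the radial problem in a ball of
   radius rho in dimension N. Here ur is the r-derivative of u, one-sided at
   r = 0 and r = rho, and ut is the t-derivative of u on r = rho, one-sided at
   t = 0. *)
Record is_radial_solution {R : realType} (N : nat) (rho lambda u0 : R)
    (f g : R -> R) (T : R) (u ur : R -> R -> R) (ut : R -> R) : Prop := {
  radial_continuous :
    {within `[0, rho] `*` `[0, T[, continuous (fun p : R * R => u p.1 p.2)} ;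
  radial_derive_r : forall r t : R, 0 <= r <= rho -> 0 <= t < T ->
    is_derive_within `[0, rho] (u ^~ t) r (ur r t) ;
  radial_continuous_r : forall t : R, 0 <= t < T ->
    {within `[0, rho], continuous (ur ^~ t)} ;
  radial_derive_t : forall t : R, 0 <= t < T ->
    is_derive_within `[0, T[ (u rho) t (ut t) ;
  radial_flux_derivable : forall r t : R, 0 < r < rho -> 0 < t < T ->
    derivable (fun s : R => s ^+ N.-1 * ur s t) r 1 ;
  radial_equation : forall r t : R, 0 < r < rho -> 0 < t < T ->
    - ((r ^+ N.-1)^-1 * derive1 (fun s : R => s ^+ N.-1 * ur s t) r)
      + g (u r t) = 0 ;
  radial_center : forall t : R, 0 <= t < T -> ur 0 t = 0 ;
  radial_boundary : forall t : R, 0 <= t < T ->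
    ut t + ur rho t = lambda * f (u rho t) ;
  radial_initial : u rho 0 = u0
}.

Definition radial_solution {R : realType} (N : nat) (rho lambda u0 : R)
    (f g : R -> R) (T : R) (u : R -> R -> R) : Prop :=
  exists (ur : R -> R -> R) (ut : R -> R),
    is_radial_solution N rho lambda u0 f g T u ur ut.

(* u is real-valued and solves the problem up to T, so T is the first time at
   which u rho becomes infinite. *)
Definition radial_solution_blowing_up_at {R : realType} (N : nat)
    (rho lambda u0 : R) (f g : R -> R) (T : R) (u : R -> R -> R) : Prop :=
  [/\ 0 < T, radial_solution N rho lambda u0 f g T u &
      u rho t @[t --> T^'-] --> +oo].

(* Main.v *)
Require Import Defs.
From HB Require Import structures.
From mathcomp Require Import all_boot all_order all_algebra.
From mathcomp Require Import all_classical all_reals all_analysis.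
From mathcomp Require Import measurable_realfun ring lra.

Set Implicit Arguments.
Unset Strict Implicit.
Unset Printing Implicit Defensive.

Import Order.TTheory GRing.Theory Num.Theory.
Import numFieldNormedType.Exports.

Local Open Scope classical_set_scope.
Local Open Scope ring_scope.

(** Write c = (lambda L - 1) / L = lambda - 1 / L and y(t) = u(rho, t).

At a fixed time the profile v = u(., t), with slope w, satisfies
(r^(N-1) w)' = r^(N-1) g(v) >= 0 with w(0) = 0, so w >= 0 and v is
nondecreasing.  Multiplying the equation by the flux r^(N-1) w bounds the slope
on the sphere by the primitive G of g:
  w(rho)^2 <= 2 G(v(rho)) + constant                       (radial_slope_le).
The constant comes from the part of the ball where v may be small or negative,
and it does not depend on t.  Since L > 0, G tends to infinity, so the constant
is negligible, and the liminf gives sqrt(2 G + constant) <= (1 / L + d) f near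
infinity for every d > 0 (perturbed_sqrt_primitive_le).  The dynamic boundary
condition thus becomes y' >= (c - d) f(y) close to the blow-up time.

As Phi' = -1/f, Phi(y(t)) + (c - d) t is nonincreasing, and Phi >= 0 then yields
Phi(y(t)) >= (c - d) (T - t) (Phi_blowup_rate); this is the first claim.  The
assumptions on G and L also make 1/f integrable at infinity (integrable_inv),
so that Phi is a strictly decreasing function with limit 0 and Phi_inv inverts
it near 0 (Phi_invK).

For the second claim, let eta > 1 and s = Phi_inv(c (T - t)), which is large
near T.  If y(t) > eta s, then for some k < 1 that depends only on eta,
Phi(y(t)) < Phi(eta s) < k Phi(s) = k c (T - t), which contradicts the lower
bound on Phi(y(t)) with c - d = k c. *)

(** * Limits inferior and superior, continuity and one-sided derivatives *)

Section limf.
Context {R : realType} {X : choiceType} {T : filteredType X}.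
Context {F : set_system T} {FF : Filter F}.
Implicit Types (h : T -> R) (a : \bar R).

Lemma near_gt_limf_einf h a : (a < limf_einf (EFin \o h) F)%E ->
  \forall x \near F, (a < (h x)%:E)%E.
Proof.
rewrite limf_einfE => /ereal_sup_gt[_ [V FV <-]] aV.
apply: filterS FV => x Vx; apply: lt_le_trans aV _.
by apply: ge_ereal_inf; exists (h x)%:E => //; exists x.
Qed.

Lemma limf_einf_ge h a : (\forall x \near F, (a <= (h x)%:E)%E) ->
  (a <= limf_einf (EFin \o h) F)%E.
Proof.
move=> ah; rewrite limf_einfE; apply: le_ereal_sup_tmp.
exists (ereal_inf ((EFin \o h) @` [set x | (a <= (h x)%:E)%E])).
  by exists [set x | (a <= (h x)%:E)%E].
by apply: le_ereal_inf_tmp => _ [x ax <-].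
Qed.

Lemma near_lt_limf_esup h a : (limf_esup (EFin \o h) F < a)%E ->
  \forall x \near F, ((h x)%:E < a)%E.
Proof.
rewrite limf_esupE => /ereal_inf_lt[_ [V FV <-]] aV.
apply: filterS FV => x Vx; apply: le_lt_trans aV.
by apply: le_ereal_sup_tmp; exists (h x)%:E => //; exists x.
Qed.

Lemma limf_esup_le h a : (\forall x \near F, ((h x)%:E <= a)%E) ->
  (limf_esup (EFin \o h) F <= a)%E.
Proof.
move=> ah; rewrite limf_esupE; apply: ge_ereal_inf.
exists (ereal_sup ((EFin \o h) @` [set x | ((h x)%:E <= a)%E])).
  by exists [set x | ((h x)%:E <= a)%E].
by apply: ge_ereal_sup => _ [x ax <-].
Qed.

End limf.

Lemma locally_lipschitz_continuous (R : realType) (f : R -> R) :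
  [locally [lipschitz f x | x in [set: R]]] -> continuous f.
Proof.
move=> lf x.
have [M [_ /(_ (`|M| + 1)) MP]] := lf (x, x) (conj I I).
have /MP : M < `|M| + 1 by rewrite ltr_pwDr// ler_norm.
rewrite /dominated_by /within /= => -[[A B] /= [xA xB] AB].
apply/cvgrPdist_lt => e e0.
have M0 : 0 < `|M| + 1 by rewrite ltr_wpDl.
near=> y.
apply: le_lt_trans (AB (x, y) _ (conj I I)) _; rewrite /self_sub /=.
  by split; [exact: nbhs_singleton|near: y].
rewrite mulrC -ltr_pdivlMr//.
by near: y; exists (e / (`|M| + 1)) => //=; rewrite divr_gt0.
Unshelve. all: by end_near. Qed.

Lemma is_derive_within_interior (R : realType) (A : set R) (v : R -> R)
    (x l : R) : nbhs x A -> is_derive_within A v x l -> is_derive x 1 v l.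
Proof.
move=> nA dv.
suff H : h^-1 *: (v (h *: (1:R) + x) - v x) @[h --> 0^'] --> l.
  split; first by apply/cvg_ex; exists l.
  exact/cvg_lim.
apply/cvgrPdist_lt => e e0.
have /cvgrPdist_lt/(_ _ e0) := dv.
rewrite /within/= => -[d d0 dP].
case: nA => d' d'0 d'A.
near=> h; have h0 : h != 0 by near: h; exact: nbhs_dnbhs_neq.
have -> : h^-1 *: (v (h *: (1:R) + x) - v x) =
          (v (h + x) - v x) / (h + x - x).
  by rewrite addrK mulrC /GRing.scale/= mulr1.
have bh r : `|h| < r -> ball x r (h + x).
  by rewrite /ball/= opprD addrCA subrr addr0 normrN.
apply: dP.
- by apply: bh => //; near: h; exact: dnbhs0_lt.
- by rewrite -subr_eq0 addrK.
- by apply: d'A; apply: bh => //; near: h; exact: dnbhs0_lt.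
Unshelve. all: by end_near. Qed.

(** * Primitives of nonnegative nondecreasing functions *)

Section primitive.
Context {R : realType} (g : R -> R).
Hypothesis cg : continuous g.

Lemma is_derive_primitive (s : R) : 0 < s -> is_derive s 1 (primitive g) (g s).
Proof.
move=> s0; have si : s < s + 1 by rewrite ltrDl.
have ig : lebesgue_measure.-integrable `[0, s + 1] (EFin \o g).
  apply: continuous_compact_integrable; first exact: segment_compact.
  exact/continuous_subspaceT.
have [dG G'] := continuous_FTC1_closed si ig s0 (@cg s).
by split => //; rewrite -derive1E.
Qed.

Hypothesis g_ge0 : forall x, 0 <= g x.
Hypothesis g_incr : nondecreasing_fun g.

Lemma primitive_ge0 (s : R) : 0 <= primitive g s.
Proof. by apply: Rintegral_ge0 => x _; exact: g_ge0. Qed.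

(** A nonnegative nondecreasing g is bounded below by g a > 0 beyond any point a
    where its primitive is positive, so the primitive grows at least linearly. *)
Lemma primitive_cvgy (a : R) : 0 < a -> 0 < primitive g a ->
  primitive g x @[x --> +oo] --> +oo.
Proof.
move=> a0 Ga.
have ga : 0 < g a.
  rewrite lt_neqAle g_ge0 andbT; apply/eqP => ga0; move: Ga.
  rewrite /primitive (@eq_Rintegral _ _ _ _ _ (cst 0)) ?Rintegral_cst ?mul0r ?ltxx//.
  move=> x; rewrite inE/= in_itv/= => /andP[_ xa].
  by apply/eqP; rewrite eq_le g_ge0 andbT ga0 g_incr.
apply/cvgryPge => A; near=> x.
have ax : a <= x by near: x; apply: nbhs_pinfty_ge; rewrite num_real.
have [||c] := @MVT_segment R (primitive g) g a x ax.
- by move=> y; rewrite in_itv/= => /andP[ay _]; apply: is_derive_primitive; exact: lt_trans ay.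
- apply/subspace_continuousP => y /=; rewrite in_itv/= => /andP[ay _].
  apply: cvg_within_filter.
  apply/differentiable_continuous/derivable1_diffP.
  exact: (@ex_derive _ _ _ _ _ _ _ (is_derive_primitive (lt_le_trans a0 ay))).
rewrite in_itv/= => /andP[ac _] /eqP; rewrite subr_eq => /eqP ->.
have gac : g a <= g c by exact: g_incr.
rewrite -lerBlDr (@le_trans _ _ (A - 0))// ?lerB ?(ltW Ga)// subr0.
rewrite (@le_trans _ _ (g a * (x - a)))//; last by rewrite ler_wpM2r// subr_ge0.
rewrite -ler_pdivrMl// lerBrDr.
by near: x; apply: nbhs_pinfty_ge; rewrite num_real.
Unshelve. all: by end_near. Qed.

End primitive.

(** * Convergent integrals over half-lines and the function Phi *)

Section tail_integral.
Context {R : realType} (h : R -> R).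
Local Notation mu := (@lebesgue_measure R).

(** The integrals over [a, a + n] increase to the integral over the half-line, so
    their complements, the tails, tend to 0. *)
Lemma Rintegral_tail_small (a e : R) : (forall x, a <= x -> 0 <= h x) ->
  mu.-integrable `[a, +oo[ (EFin \o h) -> 0 < e ->
  exists2 M, a <= M & \int[mu]_(x in `[M, +oo[) h x < e.
Proof.
move=> h0 ih e0.
have ihn n : mu.-integrable `[a, a + n%:R] (EFin \o h).
  by apply: integrableS ih => //; exact: subset_itvl.
have : (\int[mu]_(x in `[a, (a + n%:R)%R]) (h x)%:E @[n --> \oo] -->
        \int[mu]_(x in \bigcup_n [set` `[a, (a + n%:R)%R]]) (h x)%:E)%E.
  apply: ge0_nondecreasing_set_cvg_integral => //=.
  - move=> n m nm; apply/subsetPset/subset_itvl.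
    by rewrite bnd_simp lerD2l ler_nat.
  - by move=> i; case/integrableP : (ihn i).
  - by move=> i x /=; rewrite in_itv/= => /andP[ax _]; rewrite lee_fin h0.
have -> : \bigcup_n [set` `[a, a + n%:R]] = [set` `[a, +oo[].
  apply/seteqP; split => x /=.
    by move=> [n _]/=; rewrite !in_itv/= => /andP[->].
  rewrite in_itv/= andbT => ax; exists (Num.truncn (x - a)).+1 => //=.
  by rewrite in_itv/= ax/= -lerBlDl ltW// truncnS_gt.
have EI A : mu.-integrable A (EFin \o h) -> measurable A ->
    (\int[mu]_(x in A) (h x)%:E = (\int[mu]_(x in A) h x)%:E)%E.
  by move=> iA mA; rewrite /Rintegral fineK//; exact: integrable_fin_num.
rewrite EI//; under eq_fun do rewrite EI//.
move=> /fine_cvgP[_] /= /cvgrPdist_lt/(_ _ e0)[n _ /(_ n (leqnn n))].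
exists (a + n%:R); first by rewrite lerDl.
rewrite -Rintegral_itv_obnd_cbnd; last first.
  apply: integrableS ih => //; apply: subset_itvr.
  by rewrite bnd_simp lerDl.
rewrite -(@Rintegral_itvB _ h (BLeft a))// ?bnd_simp ?lerDl//.
exact: (le_lt_trans (ler_norm _)).
Qed.

End tail_integral.

Section Phi.
Context {R : realType} (f : R -> R).
Local Notation mu := (@lebesgue_measure R).
Hypothesis cf : continuous f.
Hypothesis f_gt0 : forall x : R, 0 < x -> 0 < f x.
Hypothesis f_int : forall r : R, 0 < r ->
  mu.-integrable `[r, +oo[ (EFin \o (fun s => (f s)^-1)).

Lemma is_derive_Phi (r : R) : 0 < r -> is_derive r 1 (Phi f) (- (f r)^-1).
Proof.
move=> r0; pose a := r / 2.
have a0 : 0 < a by rewrite divr_gt0.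
have ar : a < r by rewrite /a; lra.
(* Near r, Phi is the constant Phi a minus the integral of 1/f from a, to which
   the fundamental theorem of calculus applies. *)
have ri : r < r + 1 by rewrite ltrDl.
have ig : lebesgue_measure.-integrable `[a, r + 1] (EFin \o (fun s => (f s)^-1)).
  by apply: integrableS (f_int a0) => //; exact: subset_itvl.
have cfr : {for r, continuous (fun s => (f s)^-1)}.
  by apply: cvgV; [rewrite gt_eqF// f_gt0|exact: cf].
have [dG G'] := continuous_FTC1_closed ri ig ar cfr.
set I := fun x => _ in dG G'.
have dI : is_derive r 1 I (f r)^-1 by split => //; rewrite -derive1E.
apply: (@near_eq_is_derive _ _ _ (fun x => Phi f a - I x)).
  near=> y; have ay : a <= y by apply: ltW; near: y; exact: lt_nbhsr.
  rewrite /Phi Rintegral_itvB ?bnd_simp//; last exact: f_int.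
  rewrite Rintegral_itv_obnd_cbnd//.
  by apply: integrableS (f_int a0) => //; apply: subset_itvr; rewrite bnd_simp.
by rewrite -sub0r; apply: (@is_deriveB _ _ _ (cst (Phi f a))).
Unshelve. all: by end_near. Qed.

Lemma Phi_decr (x y : R) : 0 < x -> x < y -> Phi f y < Phi f x.
Proof.
move=> x0 xy; have y0 := lt_trans x0 xy.
have d z : z \in `]0, y + 1[ -> is_derive z 1 (Phi f) (- (f z)^-1).
  by rewrite in_itv/= => /andP[z0 _]; exact: is_derive_Phi.
apply: (@ltr0_derive1_lt_oo R (Phi f) 0 (y + 1)) => //.
- by move=> z /d dz; exact: ex_derive.
- move=> z zi; rewrite derive1E; have [_ ->] := d _ zi.
  by rewrite oppr_lt0 invr_gt0 f_gt0//; move: zi; rewrite in_itv/= => /andP[].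
- move=> z zi; apply/differentiable_continuous/derivable1_diffP.
  exact: (@ex_derive _ _ _ _ _ _ _ (d _ (set_mem zi))).
- by rewrite in_itv/= y0/= ltrDl.
- by rewrite in_itv/= x0/= (lt_trans xy)// ltrDl.
Qed.

Lemma Phi_ge0 (r : R) : 0 < r -> 0 <= Phi f r.
Proof.
move=> r0; apply: Rintegral_ge0 => x /=; rewrite in_itv/= andbT => rx.
by rewrite invr_ge0 ltW// f_gt0// (lt_le_trans r0).
Qed.

Lemma Phi_gt0 (r : R) : 0 < r -> 0 < Phi f r.
Proof.
move=> r0; have r1 : 0 < r + 1 by rewrite addr_gt0.
by rewrite (le_lt_trans (Phi_ge0 r1))// Phi_decr ?ltrDl.
Qed.

Lemma Phi_small (e : R) : 0 < e -> exists2 M, 0 < M & Phi f M < e.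
Proof.
move=> e0; have [|M M1 PM] := Rintegral_tail_small _ (f_int ltr01) e0.
  by move=> x x1; rewrite invr_ge0 ltW// f_gt0// (lt_le_trans _ x1).
by exists M => //; exact: lt_le_trans M1.
Qed.

(** Phi is continuous and takes arbitrarily small values, so by the intermediate
    value theorem it attains every value of ]0, Phi 1], and strict monotonicity
    makes the preimage unique. *)
Lemma Phi_invK (y : R) : 0 < y -> y <= Phi f 1 ->
  0 < Phi_inv f y /\ Phi f (Phi_inv f y) = y.
Proof.
move=> y0 y1.
have [M M0 My] := Phi_small y0.
have M1 : 1 < M.
  rewrite ltNge; apply/negP => M1.
  have : Phi f 1 <= Phi f M.
    move: M1; rewrite le_eqVlt => /predU1P[->//|M1].
    by rewrite ltW// Phi_decr.
  by rewrite leNgt (lt_le_trans My).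
have [||c c1 cy] := @IVT R (Phi f) 1 M y (ltW M1).
- apply/subspace_continuousP => z /=; rewrite in_itv/= => /andP[z1 _].
  apply: cvg_within_filter; apply/differentiable_continuous/derivable1_diffP.
  exact: (@ex_derive _ _ _ _ _ _ _ (is_derive_Phi (lt_le_trans ltr01 z1))).
- by rewrite ge_min le_max y1 (ltW My) orbT.
have c0 : 0 < c.
  by move: c1; rewrite in_itv/= => /andP[c1 _]; exact: lt_le_trans c1.
rewrite -cy /Phi_inv pinvKV// ?inE//.
move=> a b; rewrite !inE/= => a0 b0 ab; apply/eqP.
by case: ltgtP => // h; [have := Phi_decr a0 h|have := Phi_decr b0 h];
  rewrite ab ltxx.
Qed.

End Phi.

(** * Slope of a radial profile on the sphere *)

(** v is the profile at a fixed time, w its slope, and k = N - 1. The hypothesis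
    dflux is the radial equation in divergence form. *)
Section radial_profile.
Context {R : realType} (k : nat) (rho : R) (g v w : R -> R).
Hypothesis rho0 : 0 < rho.
Hypothesis cg : continuous g.
Hypothesis g_ge0 : forall x, 0 <= g x.
Hypothesis g_incr : nondecreasing_fun g.
Hypothesis cv : {within `[0, rho], continuous v}.
Hypothesis cw : {within `[0, rho], continuous w}.
Hypothesis dv : forall r, 0 < r < rho -> is_derive r 1 v (w r).
Hypothesis dflux : forall r, 0 < r < rho ->
  is_derive r 1 (fun s => s ^+ k * w s) (r ^+ k * g (v r)).
Hypothesis w0 : w 0 = 0.

Let flux r := r ^+ k * w r.

Let cflux : {within `[0, rho], continuous flux}.
Proof.
apply/subspace_continuousP => x x01; apply: cvgM.
  by apply: cvg_within_filter; exact: exprn_continuous.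
by move/subspace_continuousP : cw; exact.
Qed.

Lemma radial_slope_ge0 r : 0 <= r <= rho -> 0 <= w r.
Proof.
move=> /andP[]; rewrite le_eqVlt => /predU1P[<- _|r0 rrho]; first by rewrite w0.
rewrite -(pmulr_rge0 _ (exprn_gt0 k r0)).
suff : flux 0 <= flux r by rewrite /flux w0 mulr0.
apply: (@ger0_derive1_le_cc R flux 0 rho) => //.
- move=> x; rewrite in_itv/= => /dflux dx; exact: ex_derive.
- move=> x; rewrite in_itv/= => x0; rewrite derive1E.
  have [_ ->] := dflux x0.
  by move: x0 => /andP[x0 _]; rewrite mulr_ge0 ?g_ge0// exprn_ge0// ltW.
- by rewrite in_itv/= lexx ltW.
- by rewrite in_itv/= rrho ltW.
- exact: ltW.
Qed.

Lemma radial_profile_ndecr : {in `[0, rho] &, {homo v : x y / x <= y}}.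
Proof.
apply: ger0_derive1_le_cc => //.
- move=> x; rewrite in_itv/= => /dv dx; exact: ex_derive.
- move=> x; rewrite in_itv/= => x0; rewrite derive1E; have [_ ->] := dv x0.
  by apply: radial_slope_ge0; case/andP : x0 => ? ?; rewrite !ltW.
Qed.

(** On [0, r] the flux has derivative s^k g(v s) <= rho^k g a. *)
Lemma radial_flux_le a r : 0 <= r <= rho -> v r <= a ->
  flux r <= rho ^+ k * g a * r.
Proof.
move=> /andP[r0 rrho] vra.
suff : flux r - rho ^+ k * g a * r <= flux 0 - rho ^+ k * g a * 0.
  by rewrite /flux w0 !mulr0 subr0 subr_le0.
have sub : `[0, r] `<=` `[0, rho] by apply: subset_itvl; rewrite bnd_simp.
pose dE x := x ^+ k * g (v x) - rho ^+ k * g a.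
have dE_ x : x \in `]0, r[ ->
    is_derive x 1 (fun s => flux s - rho ^+ k * g a * s) (dE x).
  rewrite in_itv/= => /andP[x0 xr].
  have xrho : 0 < x < rho by rewrite x0 (lt_le_trans xr).
  apply: (@is_deriveB _ _ _ flux (fun s => rho ^+ k * g a * s)).
    exact: dflux.
  by apply: is_derive_eq; rewrite /GRing.scale/= mulr1.
apply: (@ler0_derive1_le_cc R (fun s => flux s - rho ^+ k * g a * s) 0 r) => //.
- move=> x /dE_ dx; exact: ex_derive.
- move=> x xr; rewrite derive1E; have [_ ->] := dE_ _ xr.
  move: xr; rewrite in_itv/= => /andP[x0 xr].
  rewrite subr_le0 ler_pM ?exprn_ge0 ?(ltW x0)//.
    by rewrite lerXn2r ?nnegrE ?ltW ?(lt_le_trans xr).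
  apply: g_incr; apply: le_trans vra.
  apply: radial_profile_ndecr (ltW xr); rewrite in_itv/= ?r0//.
  by rewrite (ltW x0) (le_trans (ltW xr)).
- apply/subspace_continuousP => x xr; apply: cvgB.
    exact: (subspace_continuousP _ flux).1 (continuous_subspaceW sub cflux) x xr.
  by apply: cvg_within_filter; exact: mulrl_continuous.
- by rewrite in_itv/= lexx r0.
- by rewrite in_itv/= lexx r0.
Qed.

(** The derivative of this quantity is 2 g(v) w (s^(2k) - rho^(2k)) <= 0. Squaring
    the flux instead of w avoids differentiating w and the singular term
    (N - 1) w / r. Positivity of v a keeps v in the range where [primitive g] is
    an antiderivative of g. *)
Lemma radial_energy_le a : 0 <= a <= rho -> 0 < v a ->
  flux rho ^+ 2 - 2 * (rho ^+ k) ^+ 2 * primitive g (v rho) <=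
  flux a ^+ 2 - 2 * (rho ^+ k) ^+ 2 * primitive g (v a).
Proof.
move=> /andP[a0 arho] va0.
have sub : `[a, rho] `<=` `[0, rho] by apply: subset_itvr; rewrite bnd_simp.
have v_gt0 x : a <= x <= rho -> 0 < v x.
  move=> /andP[ax xrho]; apply: lt_le_trans va0 _.
  by apply: radial_profile_ndecr; rewrite ?in_itv/= ?a0 ?xrho ?(le_trans a0).
pose E s := flux s ^+ 2 - 2 * (rho ^+ k) ^+ 2 * primitive g (v s).
pose dE x := 2 * flux x * (x ^+ k * g (v x))
  - 2 * (rho ^+ k) ^+ 2 * (g (v x) * w x).
have dE_ x : x \in `]a, rho[ -> is_derive x 1 E (dE x).
  rewrite in_itv/= => /andP[ax xrho].
  have x0rho : 0 < x < rho by rewrite (le_lt_trans a0).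
  have vx0 : 0 < v x by rewrite v_gt0// !ltW.
  apply: (@is_deriveB _ _ _ (flux ^+ 2)
    (fun s => 2 * (rho ^+ k) ^+ 2 * (primitive g \o v) s)).
    apply: (@is_derive_eq _ _ _ _ _ _ _ _ (@is_deriveX _ _ _ 2 _ _ _ (dflux x0rho))).
    by rewrite /GRing.scale/= expr1.
  have dGv := is_derive1_comp (is_derive_primitive cg vx0) (dv x0rho).
  exact: is_deriveZ.
apply: (@ler0_derive1_le_cc R E a rho) => //.
- move=> x /dE_ dx; exact: ex_derive.
- move=> x xr; rewrite derive1E; have [_ ->] := dE_ _ xr.
  move: xr; rewrite in_itv/= => /andP[ax xrho].
  have x0 : 0 < x by exact: le_lt_trans ax.
  have -> : dE x = 2 * (g (v x) * w x) * ((x ^+ k) ^+ 2 - (rho ^+ k) ^+ 2).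
    by rewrite /dE /flux; ring.
  rewrite mulr_ge0_le0 ?mulr_ge0//.
    by apply: radial_slope_ge0; rewrite !ltW.
  by rewrite subr_le0 !lerXn2r ?nnegrE ?exprn_ge0 ?ltW.
- apply/subspace_continuousP => x xr.
  have /= /[!in_itv]/= xr' := xr.
  apply: cvgB.
    apply: cvgM;
    exact: (subspace_continuousP _ flux).1 (continuous_subspaceW sub cflux) x xr.
  apply: cvgM; first exact: cvg_cst.
  have vx : v y @[y --> within `[a, rho] (nbhs x)] --> v x.
    exact: (subspace_continuousP _ v).1 (continuous_subspaceW sub cv) x xr.
  apply: (@cvg_comp _ _ _ v (primitive g) _ _ _ vx).
  apply/differentiable_continuous/derivable1_diffP.
  exact: (@ex_derive _ _ _ _ _ _ _ (is_derive_primitive cg (v_gt0 _ xr'))).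
- by rewrite in_itv/= lexx arho.
- by rewrite in_itv/= lexx arho.
Qed.

(** The energy estimate runs from the radius where v reaches the level 1, or from
    the centre if v is above 1 everywhere; up to that radius g(v) <= g(1), so the
    flux there is at most rho^(k + 1) g(1). *)
Lemma radial_slope_le : 1 <= v rho ->
  w rho <= Num.sqrt (2 * primitive g (v rho) + (rho * g 1) ^+ 2).
Proof.
move=> v1; have rk : 0 < rho ^+ k by rewrite exprn_gt0.
have [a [a0 va fa]] : exists a, [/\ 0 <= a <= rho, 1 <= v a &
    flux a <= rho ^+ k * (rho * g 1)].
  have [v01|/ltW v01] := leP 1 (v 0).
    exists 0; split => //; first by rewrite lexx ltW.
    by rewrite /flux w0 mulr0 !mulr_ge0 ?exprn_ge0 ?(ltW rho0).
  have [|a /[!in_itv]/= a0 va] := IVT (ltW rho0) cv (v := 1).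
    by rewrite ge_min le_max v01 v1 orbT.
  exists a; split => //; first by rewrite va.
  rewrite (le_trans (radial_flux_le a0 (a := 1) _)) ?va//.
  rewrite -mulrA ler_pM2l// mulrC ler_wpM2r//.
  by case/andP : a0.
have := radial_energy_le a0 (lt_le_trans ltr01 va).
have Ga := primitive_ge0 g_ge0 (v a).
have fa0 : 0 <= flux a.
  by rewrite mulr_ge0 ?radial_slope_ge0// exprn_ge0//; case/andP : a0.
move=> En.
have wrho : 0 <= w rho by rewrite radial_slope_ge0// lexx ltW.
rewrite -[leLHS](ger0_norm wrho) -sqrtr_sqr ler_wsqrtr//.
rewrite -(ler_pM2l (exprn_gt0 2 rk)).
have fa2 : flux a ^+ 2 <= (rho ^+ k * (rho * g 1)) ^+ 2.
  by rewrite lerXn2r ?nnegrE// (le_trans fa0).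
have kGa : 0 <= 2 * (rho ^+ k) ^+ 2 * primitive g (v a).
  by apply: mulr_ge0 Ga; apply: mulr_ge0; rewrite // sqr_ge0.
have -> : (rho ^+ k) ^+ 2 * w rho ^+ 2 = flux rho ^+ 2 by rewrite -exprMn.
have -> : (rho ^+ k) ^+ 2 * (2 * primitive g (v rho) + (rho * g 1) ^+ 2) =
   2 * (rho ^+ k) ^+ 2 * primitive g (v rho) + (rho ^+ k * (rho * g 1)) ^+ 2.
  by ring.
lra.
Qed.

End radial_profile.

(** * Comparison of f with the square root of the primitive of g *)

Section growth.
Context {R : realType} (f g : R -> R) (L : R).
Local Notation mu := (@lebesgue_measure R).
Local Notation G := (primitive g).
Hypothesis cf : continuous f.
Hypothesis cg : continuous g.
Hypothesis f_gt0 : forall x : R, 0 < x -> 0 < f x.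
Hypothesis g_ge0 : forall x, 0 <= g x.
Hypothesis g_incr : nondecreasing_fun g.
Hypothesis hL : 0 < L.
Hypothesis f_liminf :
  limf_einf (fun tau : R => (f tau / Num.sqrt (2 * G tau))%:E)
    (pinfty_nbhs R) = L%:E.

(** Besides the bound that the liminf asserts, this records that G is eventually
    positive: a zero of G would make the quotient 0 and not larger than 1 / K. *)
Lemma sqrt_primitive_le (K : R) : 1 / L < K ->
  \forall tau \near +oo, 0 < Num.sqrt (2 * G tau) <= K * f tau.
Proof.
move=> LK; have K0 : 0 < K by rewrite (lt_trans _ LK)// divr_gt0.
have : \forall tau \near +oo, (K^-1%:E < (f tau / Num.sqrt (2 * G tau))%:E)%E.
  apply: near_gt_limf_einf.
  rewrite [ltRHS]f_liminf lte_fin -[L]invrK ltf_pV2 ?posrE ?invr_gt0//.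
  by rewrite -div1r.
apply: filterS => tau; rewrite lte_fin => Kf.
have s0 : 0 < Num.sqrt (2 * G tau).
  rewrite lt_neqAle sqrtr_ge0 andbT eq_sym; apply/eqP => s0.
  by move: Kf; rewrite s0 invr0 mulr0 ltNge invr_ge0 ltW.
rewrite s0/= -ler_pdivrMl// ltW//.
by move: Kf; rewrite ltr_pdivlMr.
Qed.

Lemma primitive_cvgy_of_growth : G tau @[tau --> +oo] --> +oo.
Proof.
have [a [a0 Ga]] : exists a : R, 0 < a /\ 0 < G a.
  have : \forall tau \near +oo, 0 < tau /\
      0 < Num.sqrt (2 * G tau) <= (1 / L + 1) * f tau.
    near=> tau; split; first by near: tau; apply: nbhs_pinfty_gt.
    by near: tau; apply: sqrt_primitive_le; rewrite ltrDl.
  move=> /filter_ex[a [a0 /andP[]]]; rewrite sqrtr_gt0 pmulr_rgt0// => ? _.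
  by exists a.
exact: primitive_cvgy Ga.
Unshelve. all: by end_near. Qed.

(** sqrt (2 G + C^2) <= sqrt (2 G) + C; one half of d pays for the liminf, the other
    half for C, which f eventually dominates because G tends to infinity. *)
Lemma perturbed_sqrt_primitive_le (C d : R) : 0 <= C -> 0 < d ->
  \forall tau \near +oo,
    Num.sqrt (2 * G tau + C ^+ 2) <= (1 / L + d) * f tau.
Proof.
move=> C0 d0.
have d2 : 0 < d / 2 by rewrite divr_gt0.
have Ld : 0 < 1 / L + d / 2 by rewrite addr_gt0// divr_gt0.
near=> tau.
have /andP[s0 sf] : 0 < Num.sqrt (2 * G tau) <= (1 / L + d / 2) * f tau.
  by near: tau; apply: sqrt_primitive_le; rewrite ltrDl.
have Gtau : 0 <= 2 * G tau by rewrite mulr_ge0// primitive_ge0.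
(* Since sqrt (2 G) <= (1 / L + d / 2) f, it suffices that sqrt (2 G) exceeds
   (1 / L + d / 2) C / (d / 2). *)
have Cf : C <= d / 2 * f tau.
  have : (1 / L + d / 2) * C / (d / 2) <= Num.sqrt (2 * G tau).
    set A := (X in X <= _).
    have A0 : 0 <= A by rewrite !mulr_ge0// ltW// invr_gt0.
    rewrite -(ger0_norm A0) -sqrtr_sqr ler_wsqrtr//.
    rewrite -ler_pdivrMl//.
    by near: tau; move: primitive_cvgy_of_growth => /cvgryPge; exact.
  move=> /le_trans/(_ sf).
  by rewrite -mulrA ler_pM2l// ler_pdivrMr// mulrC.
apply: (@le_trans _ _ (Num.sqrt (2 * G tau) + C)).
  rewrite -[leRHS]ger0_norm ?addr_ge0 ?sqrtr_ge0// -sqrtr_sqr ler_wsqrtr//.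
  rewrite sqrrD sqr_sqrtr// lerD2r lerDl mulrn_wge0// mulr_ge0// sqrtr_ge0.
by rewrite (le_trans (lerD sf Cf))// -mulrDl -addrA -splitr.
Unshelve. all: by end_near. Qed.

(** Beyond some M, 1/f is at most a multiple of 1/sqrt G, and on [r, M] it is
    continuous. *)
Lemma integrable_inv :
  (exists2 r0 : R, 0 < r0 & (\int[mu]_(s in `[r0, +oo[)
         ((Num.sqrt (G s))^-1)%:E < +oo)%E) ->
  forall r : R, 0 < r -> mu.-integrable `[r, +oo[ (EFin \o (fun s => (f s)^-1)).
Proof.
move=> [r0 r00 Gint] r r_gt0.
pose K := 1 / L + 1.
have K0 : 0 < K by rewrite addr_gt0// divr_gt0.
have [M [Mr Mr0 HM]] : exists M, [/\ r <= M, r0 <= M & forall s, M <= s ->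
    0 < Num.sqrt (2 * G s) <= K * f s].
  have [A [_ HA]] := sqrt_primitive_le (ltr_pwDr ltr01 (lexx (1 / L))).
  exists (Num.max (Num.max r r0) (A + 1)); split.
  - by rewrite !le_max lexx.
  - by rewrite !le_max lexx orbT.
  - move=> s; rewrite ge_max => /andP[_ As]; apply: HA.
    by rewrite (lt_le_trans _ As)// ltrDl.
have mf (a : R) : 0 < a -> measurable_fun `[a, +oo[ (fun s => (f s)^-1).
  move=> a0; apply: subspace_continuous_measurable_fun => //.
  apply/subspace_continuousP => x /=; rewrite in_itv/= andbT => ax.
  apply: cvg_within_filter; apply: cvgV; last exact: cf.
  by rewrite gt_eqF// f_gt0// (lt_le_trans a0).
have mG (a : R) : 0 < a -> measurable_fun `[a, +oo[ (fun s => (Num.sqrt (G s))^-1).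
  move=> a0.
  (* G may vanish on part of [a, +oo[, where the inverse of its square root is
     discontinuous; a real power is measurable everywhere and agrees with it. *)
  have -> : (fun s => (Num.sqrt (G s))^-1) =
      (fun x : R => x `^ (-1)) \o (fun s => Num.sqrt (G s)).
    by apply/funext => s /=; rewrite powR_inv1// sqrtr_ge0.
  apply: measurableT_comp; first exact: measurable_powR.
  apply: subspace_continuous_measurable_fun => //.
  apply/subspace_continuousP => x /=; rewrite in_itv/= andbT => ax.
  apply: cvg_within_filter.
  apply: (@cvg_comp _ _ _ G Num.sqrt _ (nbhs (G x))); last exact: sqrt_continuous.
  apply/differentiable_continuous/derivable1_diffP.
  exact: (@ex_derive _ _ _ _ _ _ _ (is_derive_primitive cg (lt_le_trans a0 ax))).
have finM : (\int[mu]_(s in `[M, +oo[) (f s)^-1%:E < +oo)%E.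
  have M0 : 0 < M by exact: lt_le_trans Mr.
  apply: (@le_lt_trans _ _
     (\int[mu]_(s in `[M, +oo[) (K%:E * ((Num.sqrt (G s))^-1)%:E))%E).
    apply: ge0_le_integral => //.
    - move=> x /=; rewrite in_itv/= andbT => Mx.
      by rewrite lee_fin invr_ge0 ltW// f_gt0// (lt_le_trans M0).
    - by apply/measurable_EFinP; exact: mf.
    - apply/measurable_EFinP; apply: measurable_funM => //; exact: mG.
    - move=> x /=; rewrite in_itv/= andbT => Mx.
      have /andP[s0 sK] := HM _ Mx.
      have fx : 0 < f x by rewrite f_gt0// (lt_le_trans M0).
      have Gx : 0 < Num.sqrt (G x).
        by move: s0; rewrite !sqrtr_gt0 pmulr_rgt0.
      rewrite -EFinM lee_fin ler_pdivlMr// ler_pdivrMl// mulrC.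
      apply: le_trans sK; rewrite ler_wsqrtr//.
      by rewrite ler_peMl ?ler1n// primitive_ge0.
  rewrite ge0_integralZl_EFin ?(ltW K0)//; last first.
    by apply/measurable_EFinP; exact: mG.
  apply: lte_mul_pinfty; [by rewrite lee_fin ltW|by []|].
  apply: le_lt_trans Gint; apply: ge0_subset_integral => //=.
  - by apply/measurable_EFinP; exact: mG.
  - by apply: subset_itvr; rewrite bnd_simp.
apply/integrableP; split; first by apply/measurable_EFinP; exact: mf.
have -> : (\int[mu]_(x in `[r, +oo[) `|(EFin \o (fun s : R => ((f s)^-1)%R)) x| =
    \int[mu]_(x in `[r, +oo[) (f x)^-1%:E)%E.
  apply: eq_integral => x; rewrite inE/= in_itv/= andbT => rx.
  by rewrite ger0_norm// invr_ge0 ltW// f_gt0// (lt_le_trans r_gt0).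
have E : `[r, +oo[%classic = `[r, M[ `|` `[M, +oo[.
  by apply: itv_bndbnd_setU; rewrite ?bnd_simp.
have mfrM : measurable_fun (`[r, M[ `|` `[M, +oo[) (fun s => (f s)^-1).
  by rewrite -E; exact: mf.
rewrite E ge0_integral_setU//=; last 3 first.
- exact/measurable_EFinP.
- move=> x rx; have {}rx : r <= x.
    case: rx; rewrite in_itv/=; first by case/andP.
    by rewrite andbT; exact: le_trans.
  by rewrite lee_fin invr_ge0 ltW// f_gt0// (lt_le_trans r_gt0).
- apply/disj_setPS => x [/=]; rewrite !in_itv/= => /andP[_ xM].
  by rewrite andbT leNgt xM.
have ifrM : mu.-integrable `[r, M] (EFin \o (fun s => (f s)^-1)).
  apply: continuous_compact_integrable; first exact: segment_compact.
  apply/subspace_continuousP => x /=; rewrite in_itv/= => /andP[rx _].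
  apply: cvg_within_filter; apply: cvgV; last exact: cf.
  by rewrite gt_eqF// f_gt0// (lt_le_trans r_gt0).
rewrite lte_add_pinfty//.
have ifrM' : mu.-integrable `[r, M[ (EFin \o (fun s => (f s)^-1)).
  by apply: integrableS ifrM => //; apply: subset_itvl; rewrite bnd_simp.
by rewrite ltey_eq (integrable_fin_num _ ifrM').
Qed.

End growth.

(** * The differential inequality on the boundary and the blow-up rate *)

(** The slope estimate turns the boundary condition into an ordinary differential
    inequality for u rho alone, whose error term (rho * g 1) ^+ 2 is the same at
    all times. *)
Lemma radial_solution_boundary (R : realType) (N : nat) (rho lambda u0 : R)
    (f g : R -> R) (T : R) (u ur : R -> R -> R) (ut : R -> R) (t : R) :
  0 < rho -> continuous g -> (forall x, 0 <= g x) -> nondecreasing_fun g ->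
  is_radial_solution N rho lambda u0 f g T u ur ut ->
  0 < t < T -> 1 <= u rho t ->
  is_derive t 1 (u rho) (ut t) /\
  lambda * f (u rho t) -
    Num.sqrt (2 * primitive g (u rho t) + (rho * g 1) ^+ 2) <= ut t.
Proof.
move=> rho0 cg g_ge0 g_incr sol /andP[t0 tT] u1.
have tT' : 0 <= t < T by rewrite ltW.
split.
  apply: is_derive_within_interior (radial_derive_t sol tT').
  have nT : \forall s \near t, s \in `]0, T[.
    by apply: near_in_itvoo; rewrite in_itv/= t0 tT.
  by apply: filterS nT => s; rewrite /= !in_itv/= => /andP[/ltW -> ->].
suff : ur rho t <= Num.sqrt (2 * primitive g (u rho t) + (rho * g 1) ^+ 2).
  by move=> w_le; rewrite -(radial_boundary sol tT') lerBlDr lerD2l.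
apply: (@radial_slope_le R N.-1 rho g (u ^~ t) (ur ^~ t)) => //.
- apply/subspace_continuousP => r /= rr.
  have tI : `[0, T[%classic t by rewrite /= in_itv/= ltW.
  have := (subspace_continuousP _ _).1 (radial_continuous sol) (r, t) (conj rr tI).
  apply: (@cvg_comp _ _ _ (fun s => (s, t)) (fun p => u p.1 p.2)).
  move=> A [[P Q] [Pr Qt] PQA]; apply: (filterS _ Pr) => s Ps sr.
  by apply: (PQA (s, t)); split => //; exact: nbhs_singleton.
- exact: radial_continuous_r sol _ tT'.
- move=> r /andP[r0 rrho].
  have rr : 0 <= r <= rho by rewrite !ltW.
  apply: is_derive_within_interior (radial_derive_r sol rr tT').
  have nr : \forall s \near r, s \in `]0, rho[.
    by apply: near_in_itvoo; rewrite in_itv/= r0 rrho.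
  by apply: filterS nr => s; rewrite /= !in_itv/= => /andP[/ltW -> /ltW ->].
- move=> r rr; have t_in : 0 < t < T by rewrite t0.
  have [r0 _] := andP rr.
  have dflux := radial_flux_derivable sol rr t_in.
  split; first exact: dflux.
  rewrite -derive1E; have /eqP := radial_equation sol rr t_in.
  rewrite addrC subr_eq0 => /eqP ->.
  by rewrite mulrA divff ?mul1r// gt_eqF// exprn_gt0.
- exact: radial_center sol _ tT'.
Qed.

(** Phi (y s) + c s is nonincreasing because Phi' = - 1/f, and Phi >= 0, so
    c s <= Phi (y t) + c t for every s between t and T; let s tend to T. *)
Lemma Phi_blowup_rate (R : realType) (f y dy : R -> R) (t0 T c : R) :
  continuous f -> (forall x : R, 0 < x -> 0 < f x) ->
  (forall r : R, 0 < r ->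
    lebesgue_measure.-integrable `[r, +oo[ (EFin \o (fun s => (f s)^-1))) ->
  (forall t, t0 < t < T -> 0 < y t /\ is_derive t 1 y (dy t)) ->
  (forall t, t0 < t < T -> c * f (y t) <= dy t) ->
  forall t, t0 < t < T -> c * (T - t) <= Phi f (y t).
Proof.
move=> cf f_gt0 f_int dy_ dy_ge t /andP[t0t tT].
pose E s := Phi f (y s) + c * s.
pose dE s := - (f (y s))^-1 * dy s + c.
have dE_ s : s \in `]t0, T[ -> is_derive s 1 E (dE s).
  rewrite in_itv/= => /dy_[y0 dys].
  have dP := is_derive1_comp (is_derive_Phi cf f_gt0 f_int y0) dys.
  apply: (@is_deriveD _ _ _ (Phi f \o y) (fun s => c * s)) => //.
  by apply: is_derive_eq; rewrite /GRing.scale/= mulr1.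
have E_decr s : t < s < T -> c * s <= E t.
  move=> /andP[ts sT].
  have : E s <= E t.
    apply: (@ler0_derive1_le_oo R E t0 T) => //.
    - move=> x /dE_ dx; exact: ex_derive.
    - move=> x xi; rewrite derive1E; have [_ ->] := dE_ _ xi.
      move: xi; rewrite in_itv/= => xi.
      have [y0 _] := dy_ _ xi; have := dy_ge _ xi.
      by rewrite -ler_pdivlMr ?f_gt0// mulrC /dE mulNr addrC subr_le0.
    - move=> x xi; apply/differentiable_continuous/derivable1_diffP.
      exact: (@ex_derive _ _ _ _ _ _ _ (dE_ _ (set_mem xi))).
    - by rewrite in_itv/= sT (lt_trans t0t).
    - by rewrite in_itv/= t0t tT.
    - exact: ltW.
  apply: le_trans; rewrite lerDr Phi_ge0//.
  by have [] := dy_ s; rewrite // sT (lt_trans t0t).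
rewrite mulrBr lerBlDr leNgt; apply/negP => EcT.
have : \forall s \near T^'-, E t < c * s.
  apply: (@cvgr_gt _ _ _ _ _ (c * T)) => //.
  by apply: cvg_within_filter; exact: mulrl_continuous.
move=> H; have : \forall s \near T^'-, False.
  near=> s; have : E t < c * s by near: s.
  rewrite ltNge E_decr// (_ : t < s)//=; near: s; exact: nbhs_left_gt.
by move/filter_ex => [].
Unshelve. all: by end_near. Qed.

(** Near T, u rho is so large that the perturbation of 2 G by a constant costs only
    d, so the boundary inequality reads y' >= (c - d) f(y). *)
Lemma blowup_rate (R : realType) (N : nat) (rho u0 lambda L : R)
    (f g : R -> R) (T : R) (u : R -> R -> R) (d : R) :
  0 < rho -> continuous f -> (forall x : R, 0 < x -> 0 < f x) ->
  continuous g -> (forall x, 0 <= g x) -> nondecreasing_fun g -> 0 < L ->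
  limf_einf (fun tau : R => (f tau / Num.sqrt (2 * primitive g tau))%:E)
    (pinfty_nbhs R) = L%:E ->
  (forall r : R, 0 < r ->
    lebesgue_measure.-integrable `[r, +oo[ (EFin \o (fun s => (f s)^-1))) ->
  radial_solution_blowing_up_at N rho lambda u0 f g T u ->
  0 < d ->
  \forall t \near T^'-,
    ((lambda * L - 1) / L - d) * (T - t) <= Phi f (u rho t).
Proof.
move=> rho0 cf f_gt0 cg g_ge0 g_incr L0 f_liminf f_int.
move=> [T0 [ur [ut sol]] uy] d0.
have C0 : 0 <= rho * g 1 by rewrite mulr_ge0// ltW.
have := perturbed_sqrt_primitive_le cg g_ge0 g_incr L0 f_liminf C0 d0.
move=> [A [_ HA]].
have : \forall t \near T^'-, 1 <= u rho t /\ A < u rho t.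
  near=> t; split; near: t.
    by move/cvgryPge : uy; exact.
  by move/cvgryPgt : uy; exact.
move=> [e /= e0 He].
pose t0 := Num.max 0 (T - e).
have Ht t : t0 < t < T -> [/\ 0 < t < T, 1 <= u rho t & A < u rho t].
  rewrite /t0 gt_max => /andP[/andP[t_gt0 Tet] tT].
  have [] // := He t; last by move=> u1 uA; split; rewrite // t_gt0.
  by rewrite /ball_/= ger0_norm ?subr_ge0 ?ltW// ltrBlDr addrC -ltrBlDr.
have t0T : t0 < T by rewrite /t0 gt_max T0 ltrBlDr ltrDl.
near=> t; apply: (@Phi_blowup_rate R f (u rho) ut t0 T) => //.
- move=> s /Ht[s0 u1 _]; split; first exact: lt_le_trans u1.
  by have [] := radial_solution_boundary rho0 cg g_ge0 g_incr sol s0 u1.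
- move=> s /Ht[s0 u1 uA].
  have [_] := radial_solution_boundary rho0 cg g_ge0 g_incr sol s0 u1.
  apply: le_trans; have := HA _ uA => /= /(lerB (lexx (lambda * f (u rho s)))).
  apply: le_trans; rewrite le_eqVlt; apply/orP; left; apply/eqP.
  by field; rewrite gt_eqF.
- apply/andP; split; near: t; first exact: nbhs_left_gt.
  exact: nbhs_left_lt.
Unshelve. all: by end_near. Qed.

Theorem theorem7 (R : realType) (N : nat) (rho u0 lambda L : R)
    (f g : R -> R) (T : R) (u : R -> R -> R)
    (hN : (1 < N)%N) (hrho : 0 < rho) (hu0 : 0 < u0)
    (f_lip : [locally [lipschitz f x | x in [set: R]]])
    (g_lip : [locally [lipschitz g x | x in [set: R]]])
    (f_ge0 : forall x : R, 0 <= f x) (g_ge0 : forall x : R, 0 <= g x)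
    (f_incr : nondecreasing_fun f) (g_incr : nondecreasing_fun g)
    (hlambda : 0 < lambda)
    (hlambda_f : forall tau : R, 0 < tau ->
      Num.sqrt (2 * primitive g tau) < lambda * f tau)
    (g_int : exists2 r0 : R, 0 < r0 &
      (\int[lebesgue_measure]_(s in `[r0, +oo[)
         ((Num.sqrt (primitive g s))^-1)%:E < +oo)%E)
    (hL : 0 < L)
    (f_liminf :
      limf_einf (fun tau : R => (f tau / Num.sqrt (2 * primitive g tau))%:E)
        (pinfty_nbhs R) = L%:E)
    (hlambda_L : 1 / L < lambda)
    (hu : radial_solution_blowing_up_at N rho lambda u0 f g T u) :
  ((((lambda * L - 1) / L)%:E <=
     limf_einf (fun t : R => (Phi f (u rho t) / (T - t))%:E) (at_left T))%E)
  /\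
  ((forall eta : R, 1 < eta ->
      (limf_esup (fun s : R => (Phi f (eta * s) / Phi f s)%:E)
         (pinfty_nbhs R) < 1)%E) ->
   (limf_esup
      (fun t : R =>
         (u rho t / Phi_inv f ((lambda * L - 1) / L * (T - t)))%:E)
      (at_left T) <= 1)%E).
Proof.
have cf := locally_lipschitz_continuous f_lip.
have cg := locally_lipschitz_continuous g_lip.
have f_gt0 (x : R) : 0 < x -> 0 < f x.
  move=> /hlambda_f /(le_lt_trans (sqrtr_ge0 _)).
  by rewrite pmulr_rgt0.
have f_int := integrable_inv cf cg f_gt0 g_ge0 hL f_liminf g_int.
pose c := (lambda * L - 1) / L.
have c0 : 0 < c by rewrite divr_gt0// subr_gt0 -ltr_pdivrMr.
have rate d : 0 < d ->
    \forall t \near T^'-, (c - d) * (T - t) <= Phi f (u rho t).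
  exact: blowup_rate hu.
split.
  apply/lee_subgt0Pr => d d0; apply: limf_einf_ge.
  near=> t; have tT : t < T by near: t; exact: nbhs_left_lt.
  rewrite -EFinB lee_fin ler_pdivlMr ?subr_gt0//.
  by near: t; exact: rate.
move=> Phi_ratio; apply/lee_addgt0Pr => e e0; apply: limf_esup_le.
have eta1 : 1 < 1 + e by rewrite ltrDl.
have [k [k1 Hk]] : exists k : R, k < 1 /\
    \forall s \near +oo, Phi f ((1 + e) * s) / Phi f s < k.
  have := Phi_ratio _ eta1.
  set q := limf_esup _ _ => q1.
  have [k k1 qk] : exists2 k : R, k < 1 & (q < k%:E)%E.
    case: q q1 => [r|//|_]; last by exists 0; rewrite ?ltr01 ?ltNyr.
    rewrite lte_fin => r1; exists ((r + 1) / 2); rewrite ?lte_fin; lra.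
  exists k; split => //; near=> s; rewrite -lte_fin; near: s.
  exact: near_lt_limf_esup qk.
have [S0 [S0_gt0 HS]] : exists S0 : R, 0 < S0 /\
    forall s, S0 < s -> Phi f ((1 + e) * s) < k * Phi f s.
  case: Hk => A [_ HA]; exists (Num.max 1 A); split.
    by rewrite lt_max ltr01.
  move=> s; rewrite gt_max => /andP[s1 As].
  rewrite -ltr_pdivrMr; first exact: HA.
  by apply: Phi_gt0 => //; exact: lt_trans s1.
(* This loss makes c - d equal to k * c. *)
pose d := (1 - k) * c.
have d0 : 0 < d by rewrite mulr_gt0// subr_gt0.
(* For T - t < e', Phi_inv inverts Phi at c * (T - t) and its value exceeds S0. *)
pose e' := Num.min (Phi f 1) (Phi f S0) / c.
have e'0 : 0 < e' by rewrite divr_gt0// lt_min !Phi_gt0.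
near=> t.
have tT : t < T by near: t; exact: nbhs_left_lt.
have Tt0 : 0 < T - t by rewrite subr_gt0.
have : T - e' < t by near: t; apply: nbhs_left_gt; rewrite ltrBlDr ltrDl.
rewrite ltrBlDr -ltrBlDl ltr_pdivlMr// mulrC lt_min => /andP[cP1 cPS].
have [s0 Ps] := Phi_invK cf f_gt0 f_int (mulr_gt0 c0 Tt0) (ltW cP1).
rewrite -/c; set s := Phi_inv f _ in s0 Ps *.
rewrite -EFinD lee_fin ler_pdivrMr// leNgt; apply/negP => su.
have S0s : S0 < s.
  rewrite ltNge le_eqVlt; apply/negP => /predU1P[sS|sS].
    by move: cPS; rewrite -Ps sS ltxx.
  by have := Phi_decr cf f_gt0 f_int s0 sS; rewrite Ps ltNge (ltW cPS).
have : Phi f (u rho t) < Phi f ((1 + e) * s).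
  by apply: Phi_decr su => //; rewrite mulr_gt0// (lt_trans _ eta1).
rewrite ltNge => /negP; apply.
rewrite (le_trans (ltW (HS _ S0s)))// Ps.
have -> : k * (c * (T - t)) = (c - d) * (T - t) by rewrite /d; ring.
by near: t; exact: rate.
Unshelve. all: by end_near. Qed.
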